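(* Let $c=v=2$, let $W_\infty\in\mathcal W_2$ satisfy $\int_0^1W_\infty(x,y)\,dy=1$ for Lebesgue-a.e. $x$ and $W_\infty>0$ Lebesgue-a.e., let $\mu(\{1\})=p_1=p\in(0,1)$, $\mu(\{2\})=p_2=1-p$, and let $\boldsymbol\alpha=(\alpha_1,\alpha_2)$ with $\alpha_1,\alpha_2\ge0$. Consider the optimization problem $$\sup_{\boldsymbol f\in\mathcal F_2}\left\{\sum_{r=1}^2\alpha_rG_{W_\infty,\mathbf 1_r}(\boldsymbol f)+\sum_{r=1}^2 h_r\int_0^1 f_r(u)\,du-\int_0^1\sum_{r=1}^2 f_r(u)\log f_r(u)\,du\right\}-\log 2,\qquad(\ast)$$ where $\boldsymbol h=(h_1,h_2)\in\mathbb R^2$ satisfies $e^{h_r}/(e^{h_1}+e^{h_2})=p_r$ for $r=1,2$. (i) If $\alpha_1+\log p_1\ne\alpha_2+\log p_2$, then $(\ast)$ has a unique maximizer. (ii) If $\alpha_1+\log p_1=\alpha_2+\log p_2$, then $(\ast)$ has exactly one maximizer if $\frac{\alpha_1+\alpha_2}2\le1$, and exactly two maximizers if $\frac{\alpha_1+\alpha_2}2>1$.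
   Context: $\mathcal W_2$ is the space of symmetric real-valued functions in $L^1([0,1]^2)$. $\mathcal F_2$ is the set of measurable $\boldsymbol f=(f_1,f_2):[0,1]\to[0,1]^2$ with $f_1(x)+f_2(x)=1$ for all $x$ (modulo a.e. equality). For $W\in\mathcal W_2$, $G_{W,\mathbf 1_r}(\boldsymbol f):=\int_{[0,1]^2}W(x_1,x_2)f_r(x_1)f_r(x_2)\,dx_1dx_2$. Convention: $0\log0=0$. *)

(* Defs.v *)
From HB Require Import structures.
From mathcomp Require Import all_boot all_order all_algebra.
From mathcomp Require Import all_classical all_reals all_analysis.

Set Implicit Arguments.
Unset Strict Implicit.
Unset Printing Implicit Defensive.

Import Order.TTheory GRing.Theory Num.Theory.
Import numFieldNormedType.Exports.

Local Open Scope classical_set_scope.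
Local Open Scope ring_scope.

(* The index r in {1, 2} is encoded as 'I_2, with 1 as [0] and 2 as [1].
   Functions on [0,1] (resp. [0,1]^2) are total functions on R (resp. R * R)
   of which only the restriction to [0,1] (resp. [0,1]^2) is used. *)

Section Definitions.
Context {R : realType}.

Local Notation leb := (@lebesgue_measure R).
Local Notation leb2 := (leb \x leb)%E.

Definition unit_itv : set R := `[0, 1]%classic.

Definition unit_sq : set (R * R) := unit_itv `*` unit_itv.

(* Symmetry is a.e. because the elements of L^1 are classes modulo a.e.
   equality. *)
Definition sym_L1 (W : R * R -> R) : Prop :=
  leb2.-integrable unit_sq (EFin \o W) /\
  {ae leb2, forall z, unit_sq z -> W z = W (z.2, z.1)}.

Definition unit_marginals (W : R * R -> R) : Prop :=
  {ae leb, forall x, unit_itv x ->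
    (\int[leb]_(y in unit_itv) (W (x, y))%:E = 1)%E}.

Definition ae_positive (W : R * R -> R) : Prop :=
  {ae leb2, forall z, unit_sq z -> 0 < W z}.

Definition F2 : set ('I_2 -> R -> R) := [set f : 'I_2 -> R -> R |
  [/\ forall r, measurable_fun unit_itv (f r),
      forall r x, unit_itv x -> 0 <= f r x <= 1
    & forall x, unit_itv x -> f 0 x + f 1 x = 1]].

Definition F2_eq (f g : 'I_2 -> R -> R) : Prop :=
  forall r, ae_eq leb unit_itv (f r) (g r).

Definition G (W : R * R -> R) (r : 'I_2) (f : 'I_2 -> R -> R) : R :=
  \int[leb2]_(z in unit_sq) (W z * f r z.1 * f r z.2).

(* [ln 0 = 0] in the library, so the convention 0 log 0 = 0 holds. *)
Definition functional (W : R * R -> R) (alpha h : 'I_2 -> R)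
    (f : 'I_2 -> R -> R) : R :=
  \sum_(r < 2) alpha r * G W r f
  + \sum_(r < 2) h r * \int[leb]_(u in unit_itv) f r u
  - \int[leb]_(u in unit_itv) (\sum_(r < 2) f r u * ln (f r u)).

Definition opt_value (W : R * R -> R) (alpha h : 'I_2 -> R) : \bar R :=
  (ereal_sup [set (functional W alpha h f)%:E | f in F2] - (ln 2)%:E)%E.

Definition maximizer (W : R * R -> R) (alpha h : 'I_2 -> R)
    (f : 'I_2 -> R -> R) : Prop :=
  F2 f /\ (functional W alpha h f - ln 2)%:E = opt_value W alpha h.

(* Maximizers are counted as elements of F2, i.e. modulo a.e. equality:
   [s] lists [n] representatives, one for each class. *)
Definition exactly_n_maximizers (n : nat) (W : R * R -> R)
    (alpha h : 'I_2 -> R) : Prop :=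
  exists s : 'I_n -> 'I_2 -> R -> R,
    [/\ forall i, maximizer W alpha h (s i),
        forall i j, F2_eq (s i) (s j) -> i = j
      & forall f, maximizer W alpha h f -> exists i, F2_eq f (s i)].

(* The measure mu on {1, 2}, given by its point masses. *)
Definition mass (p : R) (r : 'I_2) : R := if r == 0 then p else 1 - p.

End Definitions.

(* Main.v *)
(* As the marginals of W are 1, the identity 2ab = a^2 + b^2 - (a - b)^2 shows
   that the functional at f = (g, 1 - g) equals, up to an additive constant,
     \int phi(g(x)) dx - (s / 2) \int\int W(x, y) (g(x) - g(y))^2 dx dy
   with s = alpha_1 + alpha_2 and phi a function of one real variable.  Hence
   it is at most max phi; equality forces g to take values in argmax phi and,
   when s > 0, to be constant, because W > 0.  So the maximizers are the
   constant functions with values in argmax phi (for s = 0 the argmax is a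
   single point).
   Up to the symmetry t |-> 1 - t, the derivative of phi is nonnegative at 1/2
   and strictly concave on [1/2, 1), so phi has a single maximizer there. *)
Require Import Defs.
From HB Require Import structures.
From mathcomp Require Import all_boot all_order all_algebra.
From mathcomp Require Import all_classical all_reals all_analysis.
From mathcomp Require Import measurable_realfun ring lra.

Set Implicit Arguments.
Unset Strict Implicit.
Unset Printing Implicit Defensive.

Import Order.TTheory GRing.Theory Num.Theory.
Import numFieldNormedType.Exports.

Local Open Scope classical_set_scope.
Local Open Scope ring_scope.

(** * Maximizers of the one-variable function [obj] on [0, 1] *)

Section OneDim.
Context {R : realType}.
Implicit Types s D t u a b c : R.

(** The negative binary entropy; it vanishes at both endpoints. *)
Definition negent t : R := t * ln t + (1 - t) * ln (1 - t).

(* On a constant pair (t, 1 - t) the functional is [obj s D t] up to an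
   additive constant, for s = alpha_1 + alpha_2 and
   D = (alpha_1 + log p_1) - (alpha_2 + log p_2). *)
Definition obj s D t : R := s * (t ^+ 2 - t) + D * t - negent t.

Definition dobj s D t : R := s * (2 * t - 1) + D - (ln t - ln (1 - t)).

(** The reflection about 1/2 flips the sign of [D], which reduces everything to [0 <= D]. *)
Lemma objC s D t : obj s D (1 - t) = obj s (- D) t + D.
Proof. by rewrite /obj /negent subKr; ring. Qed.

Lemma is_derive_ln1B t : 0 < t < 1 ->
  is_derive t 1 (fun x => ln (1 - x)) (- (1 - t)^-1).
Proof.
move=> /andP[t0 t1].
have h : is_derive (1 - t) 1 (@ln R) (1 - t)^-1 by apply: is_derive1_ln; lra.
have h2 : is_derive t 1 (fun x : R => 1 - x) (- 1).
  by apply: is_derive_eq; rewrite add0r mul1r.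
have := @is_derive1_comp R (@ln R) (fun x => 1 - x) t _ _ h h2.
by rewrite mulrN1.
Qed.

Lemma is_derive_obj s D t : 0 < t < 1 -> is_derive t 1 (obj s D) (dobj s D t).
Proof.
move=> t01; have /andP[t0 t1] := t01.
have h1 := is_derive1_ln t0.
have h2 := is_derive_ln1B t01.
rewrite /obj /negent; apply: is_derive_eq.
rewrite /dobj /GRing.scale/=.
by field; lra.
Qed.

Lemma is_derive_logit t : 0 < t < 1 ->
  is_derive t 1 (fun x => ln x - ln (1 - x)) (t * (1 - t))^-1.
Proof.
move=> t01; have /andP[t0 t1] := t01.
have h1 := is_derive1_ln t0.
have h2 := is_derive_ln1B t01.
apply: is_derive_eq.
by field; lra.
Qed.

Lemma obj_MVT s D a b : 0 < a -> a < b -> b < 1 ->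
  exists2 c, a < c < b & obj s D b - obj s D a = dobj s D c * (b - a).
Proof.
move=> a0 ab b1.
have dob x : x \in `[a, b] -> is_derive x 1 (obj s D) (dobj s D x).
  by rewrite in_itv/= => /andP[? ?]; apply: is_derive_obj; lra.
have cob : {within `[a, b], continuous (obj s D)}.
  apply: derivable_within_continuous => x xab.
  by case: (dob x xab).
have dob' x : x \in `]a, b[ -> is_derive x 1 (obj s D) (dobj s D x).
  by move=> h; apply: dob; apply: subset_itv_oo_cc.
have [c] := MVT ab dob' cob.
by rewrite in_itv/= => ? ?; exists c.
Qed.

Lemma logit_MVT a b : 0 < a -> a < b -> b < 1 ->
  exists2 c, a < c < b & (ln b - ln (1 - b)) - (ln a - ln (1 - a)) =
                         (c * (1 - c))^-1 * (b - a).
Proof.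
move=> a0 ab b1.
have dob x : x \in `[a, b] ->
    is_derive x 1 (fun x => ln x - ln (1 - x)) (x * (1 - x))^-1.
  by rewrite in_itv/= => /andP[? ?]; apply: is_derive_logit; lra.
have cob : {within `[a, b], continuous (fun x => ln x - ln (1 - x))}.
  apply: derivable_within_continuous => x xab.
  by case: (dob x xab).
have dob' x : x \in `]a, b[ ->
    is_derive x 1 (fun x => ln x - ln (1 - x)) ((fun x => (x * (1 - x))^-1) x).
  by move=> h; apply: dob; apply: subset_itv_oo_cc.
have [c] := MVT ab dob' cob.
by rewrite in_itv/= => ? ?; exists c.
Qed.

(** The chord inequality of strict concavity, with denominators cleared. The affine part of [dobj]
    cancels, and the logit is strictly convex on [1/2, 1): its slopes over [a, b] and [b, c] are
    [1 / (x * (1 - x))] at some u < v. *)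
Lemma dobj_concave s D a b c : 1 / 2 <= a -> a < b -> b < c -> c < 1 ->
  dobj s D a * (c - b) + dobj s D c * (b - a) < dobj s D b * (c - a).
Proof.
move=> a2 ab bc c1.
have [||//|u /andP[au ub] hu] := @logit_MVT a b; try lra.
have [|//|//|v /andP[bv vc] hv] := @logit_MVT b c; try lra.
have uv : (u * (1 - u))^-1 < (v * (1 - v))^-1.
  rewrite ltf_pV2 ?posrE ?mulr_gt0 ?subr_gt0//; try lra.
  (* This product equals [u * (1 - u) - v * (1 - v)]. *)
  have : 0 < (v - u) * (u + v - 1) by apply: mulr_gt0; lra.
  by rewrite !mulrBr !mulrBl; lra.
(* The two sides of the goal differ by exactly this factor times the difference of the two
   slopes. *)
have k : 0 < (b - a) * (c - b) by apply: mulr_gt0; lra.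
move: uv; rewrite -(ltr_pM2l k).
move: hu hv; rewrite /dobj.
set la := ln a - _; set lb := ln b - _; set lc := ln c - _.
move: (u * _)^-1 (v * _)^-1 => U V hu hv.
have -> : lc = lb + V * (c - b) by rewrite -hv addrC subrK.
have -> : lb = la + U * (b - a) by rewrite -hu addrC subrK.
rewrite -subr_gt0 => h; rewrite -subr_gt0.
by congr (0 < _): h; ring.
Qed.

(* Rolle gives a zero c of the derivative between a and b; by concavity the
   derivative is positive on (1/2, c), so obj c > obj a. *)
Lemma obj_eq_lt s D a b : 0 <= D -> 1 / 2 <= a -> a < b -> b < 1 ->
  obj s D a = obj s D b -> exists2 c, 1 / 2 <= c < 1 & obj s D a < obj s D c.
Proof.
move=> D0 a2 ab b1 eab.
have [||//|c /andP[ac cb]] := @obj_MVT s D a b; try lra.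
rewrite eab subrr => /esym/eqP.
rewrite mulf_eq0 [b - a == 0]subr_eq0 (gt_eqF ab) orbF => /eqP dc0.
have [||//|x /andP[ax xc]] := @obj_MVT s D a c; try lra.
have : dobj s D (1 / 2) * (c - x) + dobj s D c * (x - 1 / 2)
    < dobj s D x * (c - 1 / 2) by apply: dobj_concave; lra.
rewrite dc0 mul0r addr0.
have -> : dobj s D (1 / 2) = D.
  by rewrite /dobj (_ : 1 - 1 / 2 = 1 / 2 :> R); [field|lra].
move=> h e; exists c; first lra.
rewrite -subr_gt0 eab in e *; rewrite e.
apply: mulr_gt0; last lra.
have : 0 < dobj s D x * (c - 1 / 2).
  by apply: le_lt_trans h; apply: mulr_ge0; lra.
by rewrite pmulr_lgt0 //; lra.
Qed.

(* Within distance exp (- (s + D + 1)) of 1, the term ln (1 - t) makes the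
   derivative negative. *)
Lemma obj_endpoint s D : 0 <= s -> 0 <= D -> exists2 e, 1 / 2 < e < 1 &
  forall u, e < u <= 1 -> obj s D u < obj s D e.
Proof.
move=> s0 D0; set K := s + D + 1; set e := expR (- K).
have e0 : 0 < e by exact: expR_gt0.
have e2 : e < 1 / 2.
  rewrite /e expRN div1r ltf_pV2 ?posrE ?expR_gt0//.
  have : K != 0 by rewrite gt_eqF// /K; lra.
  by move/expR_gt1Dx; rewrite /K; lra.
have lne : ln e = - K by rewrite expRK.
exists (1 - e); first by lra.
(* [obj_MVT] stops short of 1, so the endpoint is compared by hand: [obj s D 1 = D], while the value
   at [1 - e] is [D + s * e ^+ 2 + e - (1 - e) * ln (1 - e)]. *)
move=> u /andP[eu]; rewrite le_eqVlt => /orP[/eqP->|u1].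
  rewrite /obj /negent subrr ln1 mulr0 mul0r subKr lne.
  have : ln (1 - e) < 0 by apply: ln_lt0; lra.
  move: (ln (1 - e)) => L L0.
  have h1 : (1 - e) * L < 0 by rewrite pmulr_rlt0; lra.
  have h2 : 0 <= s * e ^+ 2 by apply: mulr_ge0 => //; exact: exprn_even_ge0.
  by rewrite -subr_gt0 /K; lra.
have [||//|x /andP[ex xu] h] := @obj_MVT s D (1 - e) u; try lra.
suff dx : dobj s D x < 0.
  by rewrite -subr_lt0 h pmulr_llt0 // subr_gt0.
have l1 : ln (1 - x) < - K by rewrite -lne ltr_ln ?posrE; lra.
have l2 : - ln x <= 1.
  rewrite -lnV ?posrE; last lra.
  have x2 : x^-1 <= 2 by rewrite -[2]invrK lef_pV2 ?posrE; lra.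
  have x0 : 0 < x^-1 by rewrite invr_gt0; lra.
  have := @le_ln1Dx R (x^-1 - 1); rewrite subrKC; lra.
have h1 : 0 <= s * (1 - x) by apply: mulr_ge0; lra.
by rewrite /dobj; rewrite /K in l1; lra.
Qed.

(** Existence is the extreme value theorem on [1/2, e], as values beyond e are smaller than the one
    at e. Uniqueness: by [obj_eq_lt], two maximizers would both be beaten by a third point. *)
Lemma obj_max s D : 0 <= s -> 0 <= D -> exists2 t, 1 / 2 <= t < 1 &
  forall u, 1 / 2 <= u <= 1 -> obj s D u <= obj s D t ?= iff (u == t).
Proof.
move=> s0 D0; have [e /andP[e2 e1] he] := obj_endpoint s0 D0.
have dob x : x \in `[1 / 2, e] -> derivable (obj s D) x 1.
  rewrite in_itv/= => xe; have x01 : 0 < x < 1 by lra.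
  by case: (is_derive_obj s D x01).
have [t /[!in_itv]/= /andP[t2 te] ht] :=
  EVT_max (ltW e2) (derivable_within_continuous dob).
have tmax u : 1 / 2 <= u <= 1 -> obj s D u <= obj s D t.
  move=> /andP[u2 u1]; have [ue|eu] := leP u e.
    by apply: ht; rewrite in_itv/= u2.
  rewrite ltW// (lt_le_trans (he u _)) ?eu//.
  by apply: ht; rewrite in_itv/= lexx ltW.
exists t; first by lra.
move=> u u21; split; first exact: tmax.
apply/idP/idP => [/eqP uE|/eqP->//].
(* [obj_eq_lt] applies only below 1; a maximizer at 1 would contradict the strict drop beyond e. *)
have u1 : u < 1.
  rewrite ltNge; apply/negP => u1.
  have : obj s D e <= obj s D t by apply: tmax; lra.
  by rewrite leNgt -uE he//; lra.
apply/eqP/eqP; case: ltgtP => // ut; exfalso.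
- have [|||||c c21] := @obj_eq_lt s D u t; rewrite ?uE//; try lra.
  by rewrite ltNge tmax//; lra.
- have [|||||c c21] := @obj_eq_lt s D t u; rewrite ?uE//; try lra.
  by rewrite ltNge tmax//; lra.
Qed.

(** Reflecting u into the right half changes only the linear term, a gain of [D * (1 - 2 * u)]. *)
Lemma obj_le_sym s D u : 0 <= D -> u <= 1 / 2 ->
  obj s D u <= obj s D (1 - u) ?= iff (D * (1 - 2 * u) == 0).
Proof.
move=> D0 u2; have e : obj s D (1 - u) - obj s D u = D * (1 - 2 * u).
  by rewrite objC /obj; ring.
split; first by rewrite -subr_ge0 e mulr_ge0//; lra.
by rewrite -e subr_eq0 eq_sym.
Qed.

(** For [0 < D] every point left of 1/2 loses strictly to its reflection, so the maximizer on
    [1/2, 1] is the global one. *)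
Lemma obj_unique_gt0 s D : 0 <= s -> 0 < D -> exists2 t, 0 <= t <= 1 &
  forall u, 0 <= u <= 1 -> obj s D u <= obj s D t ?= iff (u == t).
Proof.
move=> s0 D0; have [t /andP[t2 t1] ht] := obj_max s0 (ltW D0).
exists t; first lra.
move=> u /andP[u0 u1]; have [u2|u2] := leP (1 / 2) u; first by apply: ht; lra.
have ut : (u == t) = false by apply: lt_eqF; lra.
rewrite ut; split; last apply: lt_eqF; [apply: ltW|];
  (apply: lt_le_trans (_ : obj s D (1 - u) <= _); last by apply: ht; lra);
  by rewrite (lt_leif (obj_le_sym _ _ _)) ?mulf_neq0; lra.
Qed.

Lemma obj_unique s D : 0 <= s -> D != 0 -> exists2 t, 0 <= t <= 1 &
  forall u, 0 <= u <= 1 -> obj s D u <= obj s D t ?= iff (u == t).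
Proof.
move=> s0; rewrite neq_lt => /orP[D0|]; last exact: obj_unique_gt0.
have [|t t01 ht] := @obj_unique_gt0 s (- D) s0; first by rewrite oppr_gt0.
exists (1 - t); first lra.
move=> u u01; have [|l e] := ht (1 - u); first lra.
rewrite objC opprK in l; rewrite objC opprK in e.
split; first by rewrite objC -lerBlDr.
by rewrite objC -subr_eq e; apply/eqP/eqP; lra.
Qed.

(** The logit has slope above 4 to the right of 1/2, and [s * (2 * t - 1)] has slope [2 * s]. If
    [s <= 2], the derivative is therefore negative there and [obj s 0] decreases from 1/2 on. *)
Lemma obj0_max_half s t : 0 <= s -> 1 / 2 < t < 1 ->
  (forall u, 1 / 2 <= u <= 1 -> obj s 0 u <= obj s 0 t) -> 2 < s.
Proof.
move=> s0 /andP[t2 t1] /(_ (1 / 2)) ht; rewrite ltNge; apply/negP => s2.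
have [||//|x /andP[x2 xt] h] := @obj_MVT s 0 (1 / 2) t; try lra.
have [||//|y /andP[y2 yx]] := @logit_MVT (1 / 2) x; try lra.
rewrite (_ : 1 - 1 / 2 = 1 / 2 :> R); last lra.
rewrite subrr subr0 => hy.
have : dobj s 0 x < 0.
  rewrite /dobj hy addr0.
  have y4 : 4 < (y * (1 - y))^-1.
    rewrite -[4]invrK ltf_pV2 ?posrE ?mulr_gt0//; try lra.
    have : 0 < (y - 1 / 2) * (y - 1 / 2) by apply: mulr_gt0; lra.
    by rewrite !mulrBr !mulrBl; lra.
  have h1 : 0 < ((y * (1 - y))^-1 - 4) * (x - 1 / 2) by apply: mulr_gt0; lra.
  have h2 : 0 <= (2 - s) * (2 * x - 1) by apply: mulr_ge0; lra.
  move: (_^-1) h1 => Y h1; lra.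
rewrite -(@pmulr_llt0 _ (t - 1 / 2)); last lra.
rewrite -h subr_lt0 ltNge ht//; lra.
Qed.

(** Conversely, for [2 < s] the derivative is positive just to the right of 1/2, where the logit
    slope is still below [2 * s]. *)
Lemma obj0_half_lt s : 2 < s ->
  exists2 u, 1 / 2 < u < 1 & obj s 0 (1 / 2) < obj s 0 u.
Proof.
(* Since [y * (1 - y) = 1 / 4 - (y - 1 / 2) ^+ 2], the logit slope at y is below [2 * s] as soon as
   [(y - 1 / 2) ^+ 2 < d]. The radius d itself is small enough, because d < 1/4 gives
   [d ^+ 2 < d / 2]. *)
move=> s2; set d := 1 / 4 - 1 / (2 * s).
have si : 0 < 1 / (2 * s) < 1 / 4.
  rewrite !div1r invr_gt0 ltf_pV2 ?posrE; lra.
exists (1 / 2 + d); first by rewrite /d; lra.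
have [||//|x /andP[x2 xt] h] := @obj_MVT s 0 (1 / 2) (1 / 2 + d);
  try by rewrite /d; lra.
rewrite -subr_gt0 h; apply: mulr_gt0; last by rewrite /d; lra.
have [||//|y /andP[y2 yx]] := @logit_MVT (1 / 2) x; try by rewrite /d in xt; lra.
rewrite (_ : 1 - 1 / 2 = 1 / 2 :> R); last lra.
rewrite subrr subr0 /dobj addr0 => ->.
have ys : (y * (1 - y))^-1 < 2 * s.
  rewrite -[2 * s]invrK ltf_pV2 ?posrE ?mulr_gt0 ?invr_gt0//;
    try by rewrite /d in xt; lra.
  have : (y - 1 / 2) * (y - 1 / 2) < (1 / 2) * (1 / 4 - 1 / (2 * s)).
    by apply: ltr_pM; rewrite /d in xt; lra.
  by rewrite -[(2 * s)^-1]div1r !mulrBr !mulrBl; lra.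
have h1 : 0 < (2 * s - (y * (1 - y))^-1) * (x - 1 / 2) by apply: mulr_gt0; lra.
move: (_^-1) h1 => Y h1; lra.
Qed.

(** The maximizer on [1/2, 1] cannot exceed 1/2 by [obj0_max_half]; for [D = 0] the reflection
    transfers this to the left half. *)
Lemma obj0_unique s : 0 <= s <= 2 -> forall u, 0 <= u <= 1 ->
  obj s 0 u <= obj s 0 (1 / 2) ?= iff (u == 1 / 2).
Proof.
move=> /andP[s0 s2] u /andP[u0 u1].
have [t /andP[t2 t1] ht] := obj_max s0 (lexx 0).
have te : t = 1 / 2.
  apply/eqP; rewrite eq_le t2 andbT leNgt; apply/negP => t2'.
  have := @obj0_max_half s t s0; rewrite t2' t1 ltNge s2 => h.
  by suff : false by []; apply: h => // v v21; apply: (ht v v21).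
have [u2|u2] := leP (1 / 2) u; first by rewrite -te; apply: ht; lra.
have [|l e] := ht (1 - u); first lra.
rewrite objC oppr0 addr0 te in l; rewrite objC oppr0 addr0 te in e.
by split=> //; rewrite e; apply/eqP/eqP; lra.
Qed.

(** By [obj0_half_lt] the maximizer t on [1/2, 1] is not 1/2, so its mirror image [1 - t] is a
    second one. *)
Lemma obj0_two s : 2 < s -> exists2 t, 1 / 2 < t <= 1 &
  forall u, 0 <= u <= 1 -> obj s 0 u <= obj s 0 t ?= iff ((u == t) || (u == 1 - t)).
Proof.
move=> s2; have s0 : 0 <= s by lra.
have [t /andP[t2 t1] ht] := obj_max s0 (lexx 0).
exists t.
  rewrite ltW// andbT lt_neqAle t2 andbT; apply/eqP => te.
  have [v v21] := obj0_half_lt s2.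
  by rewrite te ltNge (ht v)//; lra.
move=> u /andP[u0 u1]; have [u2|u2] := leP (1 / 2) u.
  have [|l e] := ht u; first lra.
  split=> //; rewrite e; apply/eqP/orP => [->|[]/eqP//]; first by left.
  lra.
have [|l e] := ht (1 - u); first lra.
rewrite objC oppr0 addr0 in l; rewrite objC oppr0 addr0 in e.
split=> //; rewrite e; apply/eqP/orP => [h|[]/eqP]; [right; apply/eqP|..]; lra.
Qed.

End OneDim.

(** * General integration lemmas: a.e. nonnegative integrands and a.e. equality *)

Lemma near_bounded (T : Type) (R : realType) (D : set T) (g : T -> R) (M : R) :
  (forall x, D x -> `|g x| <= M) -> [bounded g x | x in D].
Proof.
move=> gM; exists M; split; first exact: num_real.
by move=> N MN x Dx; apply: le_trans (gM x Dx) (ltW MN).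
Qed.

Section ae_ge0.
Context d (T : measurableType d) (R : realType) (mu : {measure set T -> \bar R}).
Variables (D : set T) (F : T -> R).
Hypotheses (mD : measurable D) (iF : mu.-integrable D (EFin \o F)).
Hypothesis F0 : {ae mu, forall x, D x -> 0 <= F x}.

Let mF : measurable_fun D F.
Proof. exact/measurable_EFinP/(measurable_int mu). Qed.

(** Nonnegativity is known only a.e.; passing to the absolute value makes it hold everywhere without
    changing the integral. *)
Let intE : (\int[mu]_(x in D) (F x)%:E = \int[mu]_(x in D) `|(F x)%:E|)%E.
Proof.
apply: ae_eq_integral => //;
  try (do ?apply: measurableT_comp => //; exact/measurable_EFinP).
by apply: filterS F0 => x F0x Dx /=; rewrite ger0_norm// F0x.
Qed.

Lemma ae_Rintegral_ge0 : 0 <= \int[mu]_(x in D) F x.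
Proof. by rewrite /Rintegral intE fine_ge0// integral_ge0. Qed.

Lemma ae_Rintegral_eq0 :
  \int[mu]_(x in D) F x = 0 -> {ae mu, forall x, D x -> F x = 0}.
Proof.
rewrite /Rintegral => F00.
have /(ae_eq_integral_abs _ mD (proj2 (measurable_EFinP _ _) mF)) :
    (\int[mu]_(x in D) `|(EFin \o F) x| = 0)%E.
  by rewrite -intE -(fineK (integrable_fin_num mD iF)) /comp F00.
by apply: filterS => x /[apply] -[].
Qed.

End ae_ge0.

(** Needed because [W] is symmetric only a.e.: the swapped integrand merely agrees a.e. with an
    integrable one. *)
Lemma ae_eq_integrable d (T : measurableType d) (R : realType)
    (mu : {measure set T -> \bar R}) (D : set T) (F K : T -> \bar R) :
  measurable D -> mu.-integrable D F -> measurable_fun D K -> ae_eq mu D F K ->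
  mu.-integrable D K.
Proof.
move=> mD /integrableP[mF Foo] mK FK; apply/integrableP; split => //.
rewrite (ae_eq_integral (abse \o F)) //; try exact: measurableT_comp.
by apply: filterS FK => x FKx Dx /=; rewrite FKx.
Qed.

(** * Integrals over the unit square weighted by a kernel with unit marginals *)

Section UnitInterval.
Context {R : realType}.
Local Notation leb := (@lebesgue_measure R).
Local Notation leb2 := (leb \x leb)%E.
Local Notation I := (@unit_itv R).
Local Notation I2 := (@unit_sq R).
Implicit Types (W : R * R -> R) (g : R -> R) (t : R).

Lemma measurable_unit_itv : measurable I.
Proof. exact: measurable_itv. Qed.

Lemma measurable_unit_sq : measurable I2.
Proof. by apply: measurableX; exact: measurable_unit_itv. Qed.

Lemma leb_unit_itv : leb I = 1%E.
Proof. by rewrite /unit_itv lebesgue_measure_itv /= lte_fin ltr01 oppr0 adde0. Qed.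

#[local] Hint Resolve measurable_unit_itv measurable_unit_sq : core.

#[local] Instance ae_leb_filter : Filter (nbhs (almost_everywhere leb)).
Proof. exact: ae_filter_ringOfSetsType. Qed.

#[local] Instance ae_leb2_filter : Filter (nbhs (almost_everywhere leb2)).
Proof. exact: ae_filter_ringOfSetsType. Qed.

Lemma integrable_bounded g (M : R) : measurable_fun I g ->
  (forall x, I x -> `|g x| <= M) -> leb.-integrable I (EFin \o g).
Proof.
move=> mg gM; apply: measurable_bounded_integrable => //.
  by rewrite [ltLHS]leb_unit_itv ltry.
exact: near_bounded gM.
Qed.

Lemma measurable_fst_sq g : measurable_fun I g -> measurable_fun I2 (g \o fst).
Proof.
move=> mg; apply: (@measurable_comp _ _ _ _ _ _ I) => //.
  by move=> _ [z [zI _] <-].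
exact: (measurable_funTS measurable_fst).
Qed.

Lemma measurable_snd_sq g : measurable_fun I g -> measurable_fun I2 (g \o snd).
Proof.
move=> mg; apply: (@measurable_comp _ _ _ _ _ _ I) => //.
  by move=> _ [z [_ zI] <-].
exact: (measurable_funTS measurable_snd).
Qed.

Lemma integrable_weight W (k : R * R -> R) (M : R) : sym_L1 W ->
  measurable_fun I2 k -> (forall z, I2 z -> `|k z| <= M) ->
  leb2.-integrable I2 (EFin \o (fun z => W z * k z)).
Proof.
move=> [iW _] mk kM.
exact: (@integrableMl _ _ R leb2 I2 measurable_unit_sq (EFin \o W) k iW mk
  (near_bounded kM)).
Qed.

(** Fubini: for a.e. x the factor [g x] leaves the inner integral over y, and what remains is the
    marginal 1. *)
Lemma integral_weight_fst W g (M : R) : sym_L1 W -> unit_marginals W ->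
  measurable_fun I g -> (forall x, I x -> `|g x| <= M) ->
  (\int[leb2]_(z in I2) (W z * g z.1)%:E = \int[leb]_(x in I) (g x)%:E)%E.
Proof.
move=> hW W1 mg gM.
set F := fun z : R * R => (W z * g z.1)%:E.
have iF : leb2.-integrable I2 F.
  apply: (integrable_weight (k := (g \o fst)) (M := M)) => //.
    exact: measurable_fst_sq.
  by move=> z [zI _]; exact: gM.
have iF' := (@integrable_mkcond _ _ R leb2 I2 F measurable_unit_sq).1 iF.
have iW' := (@integrable_mkcond _ _ R leb2 I2 (EFin \o W) measurable_unit_sq).1 hW.1.
(* Fubini is applied on the whole plane, to functions extended by zero outside the square. *)
rewrite integral_mkcond -(integral12_prod_meas1 iF') [RHS]integral_mkcond.
apply: ae_eq_integral => //.
- exact: measurable_fubini_F iF'.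
- by apply/(measurable_restrict _ _ _).1 => //; rewrite setTI; exact/measurable_EFinP.
- have := ae_integrable1 iW'.
  (* Pulling [g x] out requires an integrable section of [W], which is available for a.e. x. *)
  move: W1; apply: filterS2 => x W1x iWx _.
  rewrite /fubini_F patchE; case: ifPn => xI; last first.
    apply: integral0_eq => y _; rewrite patchE ifF//.
    by apply/negbTE; apply: contra xI; rewrite !inE => -[].
  have sqE (F' : R * R -> \bar R) :
      (fun y => (F' \_ I2) (x, y)) = (fun y => F' (x, y)) \_ I.
    apply/funext => y; rewrite !patchE; congr (if _ then _ else _).
    apply/idP/idP; rewrite !inE; first by case.
    by move=> yI; split => //; exact: set_mem.
  rewrite sqE -integral_mkcond /F.
  move: iWx; rewrite sqE => /(@integrable_mkcond _ _ R leb I _ measurable_unit_itv).2 iWx.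
  under eq_integral do rewrite EFinM.
  apply: etrans (@integralZr _ _ R leb I measurable_unit_itv _ iWx (g x)) _.
  by rewrite -[RHS]mul1e; congr (_ * _)%E; apply: W1x; exact: set_mem.
Qed.

(** Fubini in opposite orders turns both sides into the same iterated integral. *)
Lemma integral_swap_sq (F : R * R -> \bar R) :
  leb2.-integrable I2 F -> leb2.-integrable I2 (fun z => F (z.2, z.1)) ->
  (\int[leb2]_(z in I2) F (z.2, z.1) = \int[leb2]_(z in I2) F z)%E.
Proof.
move=> iF iFs.
have iF' := (@integrable_mkcond _ _ R leb2 I2 F measurable_unit_sq).1 iF.
have iFs' := (@integrable_mkcond _ _ R leb2 I2 (fun z => F (z.2, z.1))
  measurable_unit_sq).1 iFs.
rewrite integral_mkcond [RHS]integral_mkcond -(integral12_prod_meas1 iF').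
rewrite -(integral21_prod_meas1 iFs').
apply: eq_integral => x _; apply: eq_integral => y _; rewrite !patchE.
congr (if _ then _ else _); apply/idP/idP; rewrite !inE => -[]; by split.
Qed.

Lemma integral_weight_snd W g (M : R) : sym_L1 W -> unit_marginals W ->
  measurable_fun I g -> (forall x, I x -> `|g x| <= M) ->
  (\int[leb2]_(z in I2) (W z * g z.2)%:E = \int[leb]_(x in I) (g x)%:E)%E.
Proof.
move=> hW W1 mg gM; rewrite -(integral_weight_fst hW W1 mg gM).
set F := fun z : R * R => (W z * g z.1)%:E.
have iF : leb2.-integrable I2 F.
  apply: (integrable_weight (k := (g \o fst)) (M := M)) => //.
    exact: measurable_fst_sq.
  by move=> z [zI _]; exact: gM.
have iK : leb2.-integrable I2 (fun z => (W z * g z.2)%:E).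
  apply: (integrable_weight (k := (g \o snd)) (M := M)) => //.
    exact: measurable_snd_sq.
  by move=> z [_ zI]; exact: gM.
have mFs : measurable_fun I2 (fun z => F (z.2, z.1)).
  apply: (@measurable_comp _ _ _ _ _ _ I2 F I2 (fun z => (z.2, z.1))) => //.
  - by move=> _ [z [z1 z2] <-]; split.
  - exact: measurable_int iF.
  - exact: (measurable_funTS (@measurable_swap _ _ _ _)).
(* The symmetry of [W] enters here and reduces the second coordinate to the first. *)
have KFs : ae_eq leb2 I2 (fun z => (W z * g z.2)%:E) (fun z => F (z.2, z.1)).
  by apply: filterS hW.2 => z Wz zI2; rewrite /F (Wz zI2).
rewrite -(integral_swap_sq iF); last first.
  exact: (@ae_eq_integrable _ _ _ leb2 _ _ _ measurable_unit_sq iK mFs KFs).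
apply: ae_eq_integral => //.
exact: measurable_int iK.
Qed.

(** Expand the square in the last integral: by the two marginal lemmas each pure square contributes
    the integral of [g ^+ 2]. *)
Lemma Rintegral_weight W g : sym_L1 W -> unit_marginals W ->
  measurable_fun I g -> (forall x, I x -> 0 <= g x <= 1) ->
  \int[leb2]_(z in I2) (W z * g z.1 * g z.2) =
  \int[leb]_(x in I) (g x ^+ 2)
  - (1 / 2) * \int[leb2]_(z in I2) (W z * (g z.1 - g z.2) ^+ 2).
Proof.
move=> hW W1 mg g01.
have mg2 : measurable_fun I (fun x => g x ^+ 2) by exact: measurable_funX.
have g2M x : I x -> `|g x ^+ 2| <= 1.
  move=> /g01 /andP[g0 g1]; rewrite ger0_norm ?exprn_even_ge0//.
  by rewrite expr_le1.
have m1 := measurable_fst_sq mg.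
have m2 := measurable_snd_sq mg.
have i1 : leb2.-integrable I2 (EFin \o (fun z => W z * (fun x => g x ^+ 2) z.1)).
  apply: (integrable_weight (k := ((fun x => g x ^+ 2) \o fst)) (M := 1)) => //.
    exact: measurable_fst_sq.
  by move=> z [zI _]; exact: g2M.
have i2 : leb2.-integrable I2 (EFin \o (fun z => W z * (fun x => g x ^+ 2) z.2)).
  apply: (integrable_weight (k := ((fun x => g x ^+ 2) \o snd)) (M := 1)) => //.
    exact: measurable_snd_sq.
  by move=> z [_ zI]; exact: g2M.
have ip : leb2.-integrable I2 (EFin \o (fun z => W z * g z.1 * g z.2)).
  have -> : (fun z => W z * g z.1 * g z.2) = (fun z => W z * (g z.1 * g z.2)).
    by apply/funext => z; rewrite mulrA.
  apply: (integrable_weight (M := 1)) => //; first exact: measurable_funM.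
  move=> z [/= /g01 /andP[a0 a1] /g01 /andP[b0 b1]].
  by rewrite ger0_norm ?mulr_ge0// mulr_ile1.
have e1 : \int[leb2]_(z in I2) (W z * g z.1 ^+ 2) = \int[leb]_(x in I) (g x ^+ 2).
  by congr fine; exact: (integral_weight_fst hW W1 mg2 g2M).
have e2 : \int[leb2]_(z in I2) (W z * g z.2 ^+ 2) = \int[leb]_(x in I) (g x ^+ 2).
  by congr fine; exact: (integral_weight_snd hW W1 mg2 g2M).
have -> : \int[leb2]_(z in I2) (W z * (g z.1 - g z.2) ^+ 2) =
    \int[leb2]_(z in I2) (W z * g z.1 ^+ 2 + W z * g z.2 ^+ 2
                           - 2 * (W z * g z.1 * g z.2)).
  by apply: eq_Rintegral => z _; ring.
have ip2 : leb2.-integrable I2 (EFin \o (fun z => 2 * (W z * g z.1 * g z.2))).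
  have := @integrableZl _ _ R leb2 _ measurable_unit_sq 2 _ ip.
  exact.
have is12 := @integrableD _ _ R leb2 _ measurable_unit_sq _ _ i1 i2.
rewrite (@RintegralB _ _ R leb2 I2 _ _ measurable_unit_sq is12 ip2).
rewrite (@RintegralD _ _ R leb2 I2 _ _ measurable_unit_sq i1 i2).
rewrite (@RintegralZl _ _ R leb2 I2 _ 2 measurable_unit_sq ip).
by rewrite e1 e2; field.
Qed.

(* For A = {g = t} and B its complement in I, the product A x B is null. *)
Lemma ae_diagonal_const g t : measurable_fun I g ->
  {ae leb2, forall z, I2 z -> g z.1 = g z.2} ->
  {ae leb, forall x, I x -> g x = t} \/ {ae leb, forall x, I x -> g x <> t}.
Proof.
move=> mg gd.
set A := I `&` g @^-1` [set t]; set B := I `\` A.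
have mA : measurable A by apply: mg => //; exact: measurable_set1.
have mB : measurable B by exact: measurableD.
have : (leb2 (A `*` B) = 0)%E.
  apply: measure_negligible; first exact: measurableX.
  apply: negligibleS gd => z [[z1 gz1] [z2 nz2]] /= /(_ (conj z1 z2)) e.
  by apply: nz2; split => //=; rewrite -e.
rewrite [LHS]product_measure1E// => /eqP; rewrite mule_eq0 => /orP[|] /eqP m0.
- right; exists A; split => // x /= /not_implyP[xI /contrapT gx].
  by split.
- left; exists B; split => // x /= /not_implyP[xI gx].
  by split => // -[].
Qed.

(** * The functional in terms of [obj], and constant pairs *)

Implicit Types (alpha h : 'I_2 -> R) (f : 'I_2 -> R -> R).

Lemma sum_ord2 (F : 'I_2 -> R) : \sum_(r < 2) F r = F 0 + F 1.
Proof.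
by rewrite !big_ord_recl big_ord0 addr0; congr (F _ + F _); exact: val_inj.
Qed.

(** Multiplying [ln (u^-1) <= u^-1 - 1] by u gives [- u * ln u <= 1 - u]. *)
Lemma normr_xlnx (u : R) : 0 <= u <= 1 -> `|u * ln u| <= 1.
Proof.
move=> /andP[]; rewrite le_eqVlt => /predU1P[<-|u0] u1.
  by rewrite mul0r normr0.
rewrite normrM (ger0_norm (ltW u0)) ler0_norm ?ln_le0// -lnV ?posrE//.
have ui : 1 <= u^-1 by rewrite invf_ge1.
have : ln (u^-1) <= u^-1 - 1.
  by have := @le_ln1Dx R (u^-1 - 1); rewrite subrKC; apply; lra.
by rewrite -(ler_pM2l u0) mulrBr mulfV ?gt_eqF//; lra.
Qed.

Lemma integrable_unit_poly g (q : R -> R) (M : R) : measurable_fun I g ->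
  (forall x, I x -> 0 <= g x <= 1) -> measurable_fun setT q ->
  (forall u, 0 <= u <= 1 -> `|q u| <= M) ->
  leb.-integrable I (EFin \o (fun x => q (g x))).
Proof.
move=> mg g01 mq qM; apply: (integrable_bounded (M := M)).
  exact: measurableT_comp.
by move=> x xI; apply: qM; exact: g01.
Qed.

Lemma measurable_negent : measurable_fun setT (@negent R).
Proof.
apply: measurable_funD; apply: measurable_funM.
- exact: measurable_id.
- exact: measurable_ln.
- by apply: measurable_funB.
- by apply: measurableT_comp; [exact: measurable_ln|exact: measurable_funB].
Qed.

(** Substituting [f 1 = 1 - f 0] leaves one unknown function. Both components have the same squared
    differences, so the two interaction terms share one double integral, with coefficient
    [(alpha 0 + alpha 1) / 2]. *)
Lemma functionalE W alpha h f : sym_L1 W -> unit_marginals W -> F2 f ->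
  functional W alpha h f =
  \int[leb]_(x in I) obj (alpha 0 + alpha 1) (alpha 0 - alpha 1 + h 0 - h 1) (f 0 x)
  + (alpha 1 + h 1)
  - (alpha 0 + alpha 1) / 2 * \int[leb2]_(z in I2) (W z * (f 0 z.1 - f 0 z.2) ^+ 2).
Proof.
move=> hW W1 [mf f01 f1].
set s := alpha 0 + alpha 1; set D := alpha 0 - alpha 1 + h 0 - h 1.
have f1E x : I x -> f 1 x = 1 - f 0 x by move=> /f1; lra.
rewrite /functional !sum_ord2 /G.
rewrite (Rintegral_weight hW W1 (mf 0) (f01 0)).
rewrite (Rintegral_weight hW W1 (mf 1) (f01 1)).
have -> : \int[leb2]_(z in I2) (W z * (f 1 z.1 - f 1 z.2) ^+ 2) =
    \int[leb2]_(z in I2) (W z * (f 0 z.1 - f 0 z.2) ^+ 2).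
  apply: eq_Rintegral => z /set_mem[z1 z2]; rewrite (f1E _ z1) (f1E _ z2).
  by ring.
have -> : \int[leb]_(u in I) (\sum_(r < 2) f r u * ln (f r u)) =
    \int[leb]_(x in I) negent (f 0 x).
  by apply: eq_Rintegral => x /set_mem xI; rewrite sum_ord2 (f1E _ xI).
set g := f 0.
have mg : measurable_fun I g by exact: mf.
have g01 x : I x -> 0 <= g x <= 1 by exact: f01.
have ie : leb.-integrable I (EFin \o (fun x => negent (g x))).
  apply: (integrable_unit_poly (q := negent) (M := 2)) => //.
    exact: measurable_negent.
  move=> u u01; rewrite (le_trans (ler_normD _ _))// (_ : 2 = 1 + 1 :> R)//.
  by apply: lerD; apply: normr_xlnx; lra.
have i1 : leb.-integrable I (EFin \o g).
  apply: (integrable_unit_poly (q := id) (M := 1)) => // u /andP[u0 u1].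
  by rewrite ger0_norm.
have i2 : leb.-integrable I (EFin \o (fun x => g x ^+ 2)).
  apply: (integrable_unit_poly (q := (fun u => u ^+ 2)) (M := 1)) => // u /andP[u0 u1].
  by rewrite ger0_norm ?exprn_even_ge0// expr_le1.
have i0 : leb.-integrable I (EFin \o (fun=> 1)).
  by apply: (integrable_bounded (M := 1)) => // x _; rewrite normr1.
have iZ k (q : R -> R) : leb.-integrable I (EFin \o q) ->
    leb.-integrable I (EFin \o (fun x => k * q x)).
  move=> iq; have := @integrableZl _ _ R leb _ measurable_unit_itv k _ iq.
  exact.
have RZ k (q : R -> R) (iq : leb.-integrable I (EFin \o q)) :=
  @RintegralZl _ _ R leb I q k measurable_unit_itv iq.
have iD (q q' : R -> R) : leb.-integrable I (EFin \o q) ->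
    leb.-integrable I (EFin \o q') ->
    leb.-integrable I (EFin \o (fun x => q x + q' x)).
  move=> iq iq'; have := @integrableD _ _ R leb _ measurable_unit_itv _ _ iq iq'.
  exact.
have RD (q q' : R -> R) (iq : leb.-integrable I (EFin \o q))
    (iq' : leb.-integrable I (EFin \o q')) :=
  @RintegralD _ _ R leb I q q' measurable_unit_itv iq iq'.
have R1 : \int[leb]_(x in I) 1 = 1 :> R.
  rewrite (@Rintegral_cst _ _ _ leb _ measurable_unit_itv) mul1r.
  by rewrite -[RHS]/(fine (1%:E : \bar R)); congr fine; exact: leb_unit_itv.
have -> : \int[leb]_(x in I) f 1 x = 1 + -1 * \int[leb]_(x in I) g x.
  rewrite -RZ// -[X in X + _]R1 -RD//; last exact: iZ.
  by apply: eq_Rintegral => x /set_mem xI; rewrite f1E // mulN1r.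
have -> : \int[leb]_(x in I) f 1 x ^+ 2 =
    1 + (-2 * \int[leb]_(x in I) g x + \int[leb]_(x in I) g x ^+ 2).
  rewrite -RZ// -[X in X + _]R1 -RD//; last exact: iZ.
  rewrite -RD//; last by apply: iD => //; exact: iZ.
  by apply: eq_Rintegral => x /set_mem xI; rewrite f1E // /g; ring.
have -> : \int[leb]_(x in I) obj s D (g x) =
    s * \int[leb]_(x in I) g x ^+ 2
    + ((D - s) * \int[leb]_(x in I) g x + -1 * \int[leb]_(x in I) negent (g x)).
  rewrite -!RZ// -RD; [|exact: iZ|exact: iZ].
  rewrite -RD; [|exact: iZ|by apply: iD; exact: iZ].
  by apply: eq_Rintegral => x _; rewrite /obj /negent; ring.
rewrite /s /D; move: (Rintegral _ _ _) (Rintegral _ _ _) (Rintegral _ _ _) => a b c.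
by field.
Qed.

Definition cst_pair (t : R) : 'I_2 -> R -> R :=
  fun r _ => if r == 0 then t else 1 - t.

Lemma F2_cst_pair t : 0 <= t <= 1 -> F2 (cst_pair t).
Proof.
move=> t01; split=> [r|r x _|x _]; rewrite /cst_pair.
- exact: measurable_cst.
- by case: ifP => _; lra.
- by rewrite eqxx /=; ring.
Qed.

Lemma F2_eq_cst_pair f t : F2 f -> {ae leb, forall x, I x -> f 0 x = t} ->
  F2_eq f (cst_pair t).
Proof.
move=> [_ _ f1] f0 r; apply: filterS f0 => x f0x xI; rewrite /cst_pair.
have [->|r0] := eqVneq r 0; first exact: f0x.
have -> : r = 1 by case: r r0 => -[|[|//]] // ? _; exact: val_inj.
by rewrite -(f0x xI) -(f1 x xI); ring.
Qed.

(** The unit interval is not null; this separates the classes of distinct constant pairs. *)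
Lemma ae_unit_itv_const (P : Prop) : {ae leb, forall x, I x -> P} -> P.
Proof.
move=> aeP; apply: contrapT => nP.
have I0 : leb.-negligible I by apply: negligibleS aeP => x xI /= /(_ xI).
have : leb I = 0%E by apply: measure_negligible => //; exact: measurable_unit_itv.
by move=> /eqP; rewrite [X in X == _]leb_unit_itv onee_eq0.
Qed.

Lemma cst_pair_inj t t' : F2_eq (cst_pair t) (cst_pair t') -> t = t'.
Proof.
move=> /(_ 0) e; apply: ae_unit_itv_const; apply: filterS e => x /[apply].
by rewrite /cst_pair eqxx.
Qed.

Lemma integrable_obj s D (g : R -> R) : measurable_fun I g ->
  (forall x, I x -> 0 <= g x <= 1) ->
  leb.-integrable I (EFin \o (fun x => obj s D (g x))).
Proof.
(* On [0, 1] both [u ^+ 2 - u] and u are at most 1 in absolute value, and each half of the entropy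
   contributes at most 1. *)
move=> mg g01; apply: (integrable_unit_poly (M := `|s| + `|D| + 2)) => //.
  apply: measurable_funB; last exact: measurable_negent.
  apply: measurable_funD; apply: measurable_funM => //.
  by apply: measurable_funB => //; exact: measurable_funX.
move=> u u01; have h1 := normr_xlnx u01.
have h2 : `|(1 - u) * ln (1 - u)| <= 1 by apply: normr_xlnx; lra.
rewrite /obj /negent (le_trans (ler_normB _ _))//; apply: lerD; last first.
  by rewrite (le_trans (ler_normD _ _))// (_ : 2 = 1 + 1 :> R)// lerD.
rewrite (le_trans (ler_normD _ _))// !normrM.
apply: lerD; rewrite ler_piMr// ler_norml; last lra.
by move/andP: u01 => [u0 u1]; apply/andP; split; nra.
Qed.

(** * Maximizers of the functional as constant pairs with values in the argmax of [phi] *)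

Section Maximizers.
Variables (W : R * R -> R) (alpha h : 'I_2 -> R).
Hypotheses (hW : sym_L1 W) (hW1 : unit_marginals W) (hW0 : ae_positive W).
Hypothesis alpha_ge0 : forall r, 0 <= alpha r.

Local Notation s := (alpha 0 + alpha 1).
Local Notation phi := (obj s (alpha 0 - alpha 1 + h 0 - h 1)).
Local Notation c := (alpha 1 + h 1).

Let s_ge0 : 0 <= s. Proof. exact: addr_ge0. Qed.

(** The Dirichlet energy of g for the kernel [W], up to normalization. *)
Let energy (g : R -> R) := \int[leb2]_(z in I2) (W z * (g z.1 - g z.2) ^+ 2).

Let gap t (g : R -> R) := \int[leb]_(x in I) (phi t - phi (g x)).

(** Valid for every reference level t, since [0, 1] has measure 1. When t maximizes [phi], both
    subtracted terms are nonnegative. *)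
Lemma functional_gap f t : F2 f ->
  functional W alpha h f = phi t + c - (gap t (f 0) + s / 2 * energy (f 0)).
Proof.
move=> Ff; rewrite (functionalE _ _ hW hW1 Ff) /gap.
have [mf f01 _] := Ff.
have ic : leb.-integrable I (EFin \o (fun=> phi t)).
  by apply: (integrable_bounded (M := `|phi t|)).
have io := integrable_obj s (alpha 0 - alpha 1 + h 0 - h 1) (mf 0) (f01 0).
rewrite (@RintegralB _ _ R leb I _ _ measurable_unit_itv ic io).
rewrite (@Rintegral_cst _ _ _ leb _ measurable_unit_itv).
have -> : fine (leb I) = 1.
  by rewrite -[RHS]/(fine (1%:E : \bar R)); congr fine; exact: leb_unit_itv.
by rewrite /energy; ring.
Qed.

Lemma functional_cst_pair t : 0 <= t <= 1 ->
  functional W alpha h (cst_pair t) = phi t + c.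
Proof.
move=> t01; rewrite (functional_gap t (F2_cst_pair t01)).
have -> : gap t (cst_pair t 0) = 0.
  rewrite /gap /cst_pair eqxx subrr.
  by rewrite (@Rintegral_cst _ _ _ leb _ measurable_unit_itv) mul0r.
have -> : energy (cst_pair t 0) = 0.
  rewrite /energy (@eq_Rintegral _ _ _ leb2 I2 (fun=> 0)); last first.
    by move=> z _; rewrite /cst_pair eqxx subrr expr0n mulr0.
  by rewrite (@Rintegral_cst _ _ _ leb2 _ measurable_unit_sq) mul0r.
by rewrite mulr0 addr0 subr0.
Qed.

Lemma energy_integrable f : F2 f ->
  leb2.-integrable I2 (EFin \o (fun z => W z * (f 0 z.1 - f 0 z.2) ^+ 2)).
Proof.
move=> [mf f01 _]; apply: (integrable_weight (M := 1)) => //.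
  apply: measurable_funX; apply: measurable_funB.
    exact: (measurable_fst_sq (mf 0)).
  exact: (measurable_snd_sq (mf 0)).
move=> z [/(f01 0) /andP[a0 a1] /(f01 0) /andP[b0 b1]].
by rewrite normrX expr_le1// ler_norml; lra.
Qed.

Lemma energy_ae_ge0 (f : 'I_2 -> R -> R) :
  {ae leb2, forall z, I2 z -> 0 <= W z * (f 0 z.1 - f 0 z.2) ^+ 2}.
Proof.
apply: filterS hW0 => z Wz /Wz W0.
by rewrite mulr_ge0 ?exprn_even_ge0// ltW.
Qed.

Lemma energy_ge0 f : F2 f -> 0 <= energy (f 0).
Proof.
move=> Ff; exact: (@ae_Rintegral_ge0 _ _ _ leb2 _ _ measurable_unit_sq
  (energy_integrable Ff) (energy_ae_ge0 f)).
Qed.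

Lemma energy_eq0 f : F2 f -> energy (f 0) = 0 ->
  {ae leb2, forall z, I2 z -> f 0 z.1 = f 0 z.2}.
Proof.
move=> Ff /(@ae_Rintegral_eq0 _ _ _ leb2 _ _ measurable_unit_sq
  (energy_integrable Ff) (energy_ae_ge0 f)).
move: hW0; apply: filterS2 => z Wz ez zI.
have /eqP := ez zI; rewrite mulf_eq0 gt_eqF ?Wz//= expf_eq0/= subr_eq0.
by move/eqP.
Qed.

Section Argmax.
Variable t : R.
Hypotheses (t01 : 0 <= t <= 1).
Hypothesis tmax : forall u, 0 <= u <= 1 -> phi u <= phi t.

Let gap_integrable f : F2 f ->
  leb.-integrable I (EFin \o (fun x => phi t - phi (f 0 x))).
Proof.
move=> [mf f01 _].
have ic : leb.-integrable I (EFin \o (fun=> phi t)).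
  by apply: (integrable_bounded (M := `|phi t|)).
have io := integrable_obj s (alpha 0 - alpha 1 + h 0 - h 1) (mf 0) (f01 0).
have := @integrableB _ _ R leb _ measurable_unit_itv _ _ ic io.
exact.
Qed.

Lemma gap_ge0 f : F2 f -> 0 <= gap t (f 0).
Proof.
move=> [_ f01 _]; apply: Rintegral_ge0 => x xI.
by rewrite subr_ge0 tmax// f01.
Qed.

Lemma gap_eq0 f : F2 f -> gap t (f 0) = 0 ->
  {ae leb, forall x, I x -> phi (f 0 x) = phi t}.
Proof.
move=> Ff; have [_ f01 _] := Ff.
have g0 : {ae leb, forall x, I x -> 0 <= phi t - phi (f 0 x)}.
  by apply: filterE => x xI; rewrite subr_ge0 tmax// f01.
move=> /(@ae_Rintegral_eq0 _ _ _ leb _ _ measurable_unit_itv (gap_integrable Ff) g0).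
by apply: filterS => x /[apply] /eqP; rewrite subr_eq0 eq_sym => /eqP.
Qed.

Lemma functional_le f : F2 f -> functional W alpha h f <= phi t + c.
Proof.
move=> Ff; rewrite (functional_gap t Ff) gerBl addr_ge0 ?gap_ge0//.
by rewrite mulr_ge0 ?energy_ge0// divr_ge0.
Qed.

Lemma opt_valueE : opt_value W alpha h = (phi t + c - ln 2)%:E.
Proof.
rewrite /opt_value EFinB; congr (_ - _)%E; apply/eqP; rewrite eq_le.
apply/andP; split.
  by apply: ub_ereal_sup => _ [f Ff <-]; rewrite lee_fin functional_le.
apply: ereal_sup_ubound; exists (cst_pair t); first exact: F2_cst_pair.
by rewrite functional_cst_pair.
Qed.

Lemma maximizerE f :
  maximizer W alpha h f <-> F2 f /\ functional W alpha h f = phi t + c.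
Proof.
rewrite /maximizer opt_valueE; split=> -[Ff]; last by move=> ->.
by move=> /eqP; rewrite eqe => /eqP /addIr.
Qed.

Lemma maximizer_cst_pair u : 0 <= u <= 1 -> phi u = phi t ->
  maximizer W alpha h (cst_pair u).
Proof.
move=> u01 ut; apply/maximizerE; split; first exact: F2_cst_pair.
by rewrite functional_cst_pair// ut.
Qed.

(** At a maximizer two nonnegative deficits sum to 0, so both vanish. The energy carries the factor
    [s / 2] and hence gives information only if [0 < s]. *)
Lemma maximizer_ae f : maximizer W alpha h f ->
  {ae leb, forall x, I x -> phi (f 0 x) = phi t} /\
  (0 < s -> {ae leb2, forall z, I2 z -> f 0 z.1 = f 0 z.2}).
Proof.
move=> /maximizerE[Ff]; rewrite (functional_gap t Ff).
rewrite -[X in _ = X]subr0 => /addrI/oppr_inj/eqP.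
rewrite paddr_eq0 ?gap_ge0//; last first.
  by rewrite mulr_ge0 ?energy_ge0// divr_ge0.
move=> /andP[/eqP gap0 e0]; split; first exact: gap_eq0.
move=> s0; apply: energy_eq0 => //; apply/eqP.
by move: e0; rewrite mulf_eq0 gt_eqF ?divr_gt0.
Qed.

End Argmax.

(** With a single argmax the vanishing gap alone forces [f 0 = t] a.e., so [s = 0] is covered as
    well. *)
Lemma exactly_one_maximizer t : 0 <= t <= 1 ->
  (forall u, 0 <= u <= 1 -> phi u <= phi t ?= iff (u == t)) ->
  exactly_n_maximizers 1 W alpha h.
Proof.
move=> t01 tmax; have tmax' u u01 := (tmax u u01).1.
exists (fun=> cst_pair t); split.
- by move=> _; exact: (maximizer_cst_pair t01 tmax').
- by move=> i j _; rewrite !ord1.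
- move=> f fmax; exists ord0.
  have [[Ff _] [fae _]] := (fmax, maximizer_ae t01 tmax' fmax).
  apply: F2_eq_cst_pair => //; apply: filterS fae => x fx xI.
  by apply/eqP; rewrite -(tmax _ _).2 ?fx//; case: Ff => _ + _; apply.
Qed.

Lemma exactly_two_maximizers t : 0 < s -> 1 / 2 < t <= 1 ->
  (forall u, 0 <= u <= 1 -> phi u <= phi t ?= iff ((u == t) || (u == 1 - t))) ->
  exactly_n_maximizers 2 W alpha h.
Proof.
move=> s0 /andP[t2 t1] tmax; have tmax' u u01 := (tmax u u01).1.
have t01 : 0 <= t <= 1 by lra.
have t01' : 0 <= 1 - t <= 1 by lra.
have tC : phi (1 - t) = phi t by apply/eqP; rewrite (tmax _ t01').2 eqxx orbT.
exists (fun i => if i == 0 then cst_pair t else cst_pair (1 - t)); split.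
- by move=> i; case: ifP => _; exact: (maximizer_cst_pair t01 tmax').
- move=> i j; case: ifPn => i0; case: ifPn => j0.
  + by rewrite (eqP i0) (eqP j0).
  + by move=> /cst_pair_inj e; clear i0 j0; exfalso; lra.
  + by move=> /cst_pair_inj e; clear i0 j0; exfalso; lra.
  + by move=> _; move: i j i0 j0 => -[[|[|//]] ?] [[|[|//]] ?] // _ _; exact: val_inj.
- move=> f fmax; have [Ff _] := fmax; have [mf f01 _] := Ff.
  have [fae /(_ s0) fd] := maximizer_ae t01 tmax' fmax.
  have [ft|ft] := ae_diagonal_const t (mf 0) fd.
    by exists 0; exact: F2_eq_cst_pair.
  (* Here [f 0] avoids t a.e. but takes argmax values a.e., so only [1 - t] is left. *)
  exists 1; apply: F2_eq_cst_pair => //.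
  move: fae ft; apply: filterS2 => x fx ft xI.
  have := (tmax _ (f01 0 x xI)).2; rewrite fx// eqxx => /esym/orP[] /eqP //.
  by move=> /(ft xI).
Qed.

End Maximizers.

End UnitInterval.

(** * From the point masses to the parameter [D], and the case distinction *)

Lemma softmax_ln (R : realType) (h m : 'I_2 -> R) :
  (forall r, expR (h r) / (expR (h 0) + expR (h 1)) = m r) ->
  h 0 - h 1 = ln (m 0) - ln (m 1).
Proof.
move=> hm; set S := expR (h 0) + expR (h 1).
have S0 : 0 < S by rewrite addr_gt0 ?expR_gt0.
(* The normalizer [ln S] is the same for both indices and cancels in the difference. *)
have lnm r : ln (m r) = h r - ln S.
  by rewrite -hm ln_div ?posrE ?expR_gt0// expRK.
by rewrite !lnm; ring.
Qed.

Theorem proposition2p13 (R : realType) (W : R * R -> R) (p : R)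
    (alpha h : 'I_2 -> R)
    (hW : sym_L1 W) (hW1 : unit_marginals W) (hW0 : ae_positive W)
    (hp : 0 < p < 1)
    (halpha : forall r, 0 <= alpha r)
    (hh : forall r, expR (h r) / (expR (h 0) + expR (h 1)) = mass p r) :
  (alpha 0 + ln (mass p 0) <> alpha 1 + ln (mass p 1) ->
     exactly_n_maximizers 1 W alpha h)
  /\
  (alpha 0 + ln (mass p 0) = alpha 1 + ln (mass p 1) ->
     ((alpha 0 + alpha 1) / 2 <= 1 -> exactly_n_maximizers 1 W alpha h) /\
     ((alpha 0 + alpha 1) / 2 > 1 -> exactly_n_maximizers 2 W alpha h)).
Proof.
have s0 : 0 <= alpha 0 + alpha 1 by exact: addr_ge0.
(* Cases (i) and (ii) thus become [D != 0] and [D = 0] for the one-variable problem. *)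
have DE : alpha 0 - alpha 1 + h 0 - h 1 =
    (alpha 0 + ln (mass p 0)) - (alpha 1 + ln (mass p 1)).
  by have := softmax_ln hh; lra.
split=> [neq|eq].
  have D0 : alpha 0 - alpha 1 + h 0 - h 1 != 0.
    by rewrite DE subr_eq0; apply/eqP.
  have [t t01 tmax] := obj_unique s0 D0.
  exact: (exactly_one_maximizer hW hW1 hW0 halpha t01).
have D0 : alpha 0 - alpha 1 + h 0 - h 1 = 0 by rewrite DE eq subrr.
split=> s2.
  apply: (@exactly_one_maximizer _ _ _ h hW hW1 hW0 halpha (1 / 2)) => [|u u01].
    by lra.
  by rewrite D0; apply: obj0_unique => //; lra.
have [|t t01 tmax] := @obj0_two R (alpha 0 + alpha 1); first lra.
apply: (@exactly_two_maximizers _ _ _ h hW hW1 hW0 halpha t) => //; first lra.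
by rewrite D0.
Qed.
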